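(* Let $k$ be an algebraically closed field of characteristic $3$. Let $f:S\to\mathbf{P}^1$ be a quasi-elliptic K3 surface with $10$ singular fibers of type $\mathrm{IV}$, given (up to birational equivalence over $\mathbf{P}^1$) by $y^2=x^3+a_{12}(t)$ with $$a_{12}(t)=t^{10}+a_8^3t^8+a_7^3t^7+a_5^3t^5+a_4^3t^4+t^2\qquad(a_4,a_5,a_7,a_8\in k),$$ where $a_{12}'(t)=0$ has only simple roots. Then the set of solutions $(c_0,c_1,c_2,c_3)\in k^4$ of the system $$\left\{\begin{array}{l} c_0=c_0^3\\ c_3=c_3^3\\ c_1=c_2^3-a_4c_2-a_5c_0\\ c_2^9-(a_4^3+a_8)c_2^3+(a_4a_8-1)c_2+(a_8a_5-a_5^3)c_0-a_7c_3=0\\ a_8c_0+a_5c_1+a_7c_2+a_4c_3=0 \end{array}\right.$$ forms (under addition in $k^4$) a finite abelian group isomorphic to $(\mathbb{Z}/3\mathbb{Z})^r$, where $r$ is the Mordell--Weil torsion rank of $f:S\to\mathbf{P}^1$.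
   Context: The quasi-elliptic surface is relatively minimal and has a section. The Mordell--Weil group $\mathrm{MW}(S)$ is the group of sections of $f$; with $u=x/y$, $v=1/y$ it is identified with the group of solutions $(u,v)\in k(t)^2$ of $u^3=v-a_{12}(t)v^3$ under componentwise addition. In characteristic $3$ one has $\mathrm{MW}(S)\cong(\mathbb{Z}/3\mathbb{Z})^r$, and $r$ is called the (Mordell--Weil) torsion rank. By a result of Ito, every quasi-elliptic K3 surface with $10$ singular fibers of type $\mathrm{IV}$ (and a section) over $\mathbf{P}^1$ in characteristic $3$ can be put in the form given in the claim. *)

(* Defs.v *)
From HB Require Import structures.
From mathcomp Require Import all_boot all_order all_algebra.

Set Implicit Arguments.
Unset Strict Implicit.
Unset Printing Implicit Defensive.

Import GRing.Theory.
Local Open Scope ring_scope.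

(* f is an isomorphism from (Z/3Z)^r onto the set A equipped with add. *)
Definition iso_Z3 (T : Type) (A : pred T) (add : T -> T -> T) (r : nat)
    (f : 'rV['Z_3]_r -> T) : Prop :=
  [/\ injective f,
      forall P, A P <-> exists v, f v = P
    & forall v w, f (v + w) = add (f v) (f w)].

Definition isog_Z3 (T : Type) (A : pred T) (add : T -> T -> T) (r : nat) : Prop :=
  exists f : 'rV['Z_3]_r -> T, iso_Z3 A add f.

(* K-points of the plane cubic y^2 = x^3 + b: None is the flex at infinity
   (the zero section) and Some (x, y) an affine point. *)
Definition wpoint (K : fieldType) : Type := option (K * K).

Definition on_cubic (K : fieldType) (b : K) (P : wpoint K) : bool :=
  if P is Some (x, y) then y ^+ 2 == x ^+ 3 + b else true.

(* Chord-tangent law with the point at infinity as origin. The slope of the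
   tangent is only used at points with y != 0; the K-points with y = 0
   (in characteristic 3, the cusp) do not exist when b is not a cube in K. *)
Definition wadd (K : fieldType) (P Q : wpoint K) : wpoint K :=
  match P, Q with
  | None, _ => Q
  | _, None => P
  | Some (x1, y1), Some (x2, y2) =>
      if (x1 == x2) && (y1 == - y2) then None
      else
        let l := if x1 == x2 then (3%:R * x1 ^+ 2) / (2%:R * y1)
                 else (y2 - y1) / (x2 - x1) in
        let x3 := l ^+ 2 - x1 - x2 in
        Some (x3, l * (x1 - x3) - y1)
  end.

(* The sections of y^2 = x^3 + a(t) over P^1 are the points of its generic fibre
   rational over k(t); u = x/y, v = 1/y turns the chord-tangent law on them into
   componentwise addition of the solutions of u^3 = v - a(t) v^3. *)
Definition MW (k : fieldType) (a : {poly k}) : pred (wpoint {fraction {poly k}}) :=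
  on_cubic (tofrac a).

Definition MW_torsion_rank (k : fieldType) (a : {poly k}) (r : nat) : Prop :=
  isog_Z3 (MW a) (@wadd {fraction {poly k}}) r.

Definition a12 (k : fieldType) (a4 a5 a7 a8 : k) : {poly k} :=
  'X^10 + a8 ^+ 3 *: 'X^8 + a7 ^+ 3 *: 'X^7 + a5 ^+ 3 *: 'X^5
  + a4 ^+ 3 *: 'X^4 + 'X^2.

Definition only_simple_roots (k : fieldType) (p : {poly k}) : Prop :=
  forall x, root p x -> mup x p = 1%N.

Definition solutions (k : fieldType) (a4 a5 a7 a8 : k) : pred 'rV[k]_4 :=
  fun c =>
    let c0 := c 0 0 in let c1 := c 0 1 in
    let c2 := c 0 2%:R in let c3 := c 0 3%:R in
    [&& c0 == c0 ^+ 3,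
        c3 == c3 ^+ 3,
        c1 == c2 ^+ 3 - a4 * c2 - a5 * c0,
        c2 ^+ 9 - (a4 ^+ 3 + a8) * c2 ^+ 3 + (a4 * a8 - 1) * c2
          + (a8 * a5 - a5 ^+ 3) * c0 - a7 * c3 == 0
      & a8 * c0 + a5 * c1 + a7 * c2 + a4 * c3 == 0].

(* Main.v *)
Require Import Defs.
From HB Require Import structures.
From mathcomp Require Import all_boot all_order all_algebra.
From mathcomp Require Import ring zify generic_quotient.

Set Implicit Arguments.
Unset Strict Implicit.
Unset Printing Implicit Defensive.

Import GRing.Theory.
Local Open Scope ring_scope.

(** Why the theorem is true.  Put [u = x/y], [v = 1/y], so that a section is a
    solution in [k(t)] of [u^3 = v - a v^3], and the chord-tangent law becomes
    componentwise addition ([uv_pointD]).  In characteristic 3 derivation kills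
    cubes, so [v' = a' v^3]; conversely, a rational function with zero
    derivative is a cube because [k] is perfect, so this differential equation
    for [v] alone determines the section.

    The equation bounds the poles of [v].  If [v = n/d] in lowest terms, then
    clearing denominators gives a polynomial cube [m^3 = n d^2 - a n^3], and
    differentiating it shows that [d] divides [a' n^3], hence [a']
    ([uv_solution_denominator]).  So [v = w/a'] with [w] a polynomial, and the
    differential equation becomes [w' a' - w a'' = w^3] ([numerator_eq]).
    Sections thus correspond additively to the polynomial solutions [w], for
    every [a] with [a' <> 0].

    For the given [a] of degree 10, [a'] has degree 9 and comparing degrees in
    the equation gives [deg w <= 4].  Its coefficients then say that [w] has no
    term in [t^2], and the remaining conditions, after extraction of cube roots,
    are exactly the system of the theorem for
    [w = c0 + c2^3 t + c1^3 t^3 + c3 t^4] ([numerator_of_solution]).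

    Finally the solutions of the system form a group of exponent 3, which is
    finite because [c0] and [c3] lie in the prime field, [c2] is a root of a
    monic polynomial of degree 9 determined by [c0] and [c3], and [c1] is
    determined by the others; and a finite group of exponent 3 is a power of
    [Z/3] ([finite_exponent3_isog]). *)

(** * Cubes and cube roots in characteristic 3 *)

(** The rewriting done by [ring] with an equation [n%:R = 0] only fires on
    monomials with coefficient exactly [n]; these are the coefficients that
    occur below. *)
Lemma small_multiples_of_three (R : comNzRingType) : 3%:R = 0 :> R ->
  [/\ - 3%:R = 0 :> R, 6%:R = 0 :> R, - 6%:R = 0 :> R, 9%:R = 0 :> R
    & - 9%:R = 0 :> R].
Proof.
move=> R3; have mul3 n : (3 * n)%:R = 0 :> R by rewrite natrM R3 mul0r.
by rewrite -[6%N]/(3 * 2)%N -[9%N]/(3 * 3)%N !mul3 R3 oppr0.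
Qed.

Ltac ring3 R3 :=
  let m3 := fresh in let p6 := fresh in let m6 := fresh in
  let p9 := fresh in let m9 := fresh in
  apply: subr0_eq; have [m3 p6 m6 p9 m9] := small_multiples_of_three R3;
  ring : R3 m3 p6 m6 p9 m9.

Section CharThree.
Variables (R : comNzRingType) (R3 : 3%:R = 0 :> R).

Lemma cubeD (x y : R) : (x + y) ^+ 3 = x ^+ 3 + y ^+ 3.
Proof. ring3 R3. Qed.

Lemma cubeB (x y : R) : (x - y) ^+ 3 = x ^+ 3 - y ^+ 3.
Proof. ring3 R3. Qed.

Lemma poly_char3 : 3%:R = 0 :> {poly R}.
Proof. by rewrite -polyC_natr R3. Qed.
End CharThree.

Lemma cube_inj (R : idomainType) : 3%:R = 0 :> R ->
  injective (fun x : R => x ^+ 3).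
Proof.
move=> R3 x y /eqP; rewrite -subr_eq0 -cubeB // expf_eq0 subr_eq0 /=.
by move/eqP.
Qed.

(** Frobenius on polynomials: cubing a polynomial cubes its coefficients and
    triples the exponents. *)
Lemma coef_cube (R : comNzRingType) (q : {poly R}) (i : nat) :
  3%:R = 0 :> R ->
  (q ^+ 3)`_i = if (3 %| i)%N then q`_(i %/ 3) ^+ 3 else 0.
Proof.
move=> R3; elim/poly_ind: q i => [|q c IHq] i.
  by rewrite expr0n /= !coef0 expr0n /=; case: ifP.
rewrite cubeD; last exact: poly_char3.
rewrite exprMn -polyC_exp coefD coefMXn IHq coefC.
case: i => [|[|[|i]]] //=; rewrite ?add0r ?coefD ?coefMX ?coefC ?add0r //=.
by rewrite -(addn3 i) addnK divnDr // dvdn_addl // addn1 /= !addr0.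
Qed.

Lemma cube_onto (k : closedFieldType) (c : k) : exists x, x ^+ 3 == c.
Proof.
have /closed_rootP[x] : size ('X^3 - c%:P) != 1%N by rewrite size_XnsubC.
by rewrite /root !hornerE subr_eq0 => ?; exists x.
Qed.

Definition cbrt (k : closedFieldType) (c : k) : k := xchoose (cube_onto c).

Lemma cbrtK (k : closedFieldType) (c : k) : cbrt c ^+ 3 = c.
Proof. exact/eqP/(xchooseP (cube_onto c)). Qed.

Definition pcbrt (k : closedFieldType) (p : {poly k}) : {poly k} :=
  \poly_(i < size p) cbrt p`_(3 * i).

(** Zero derivative leaves only the exponents divisible by 3, and over an
    algebraically closed field the coefficients have cube roots. *)
Lemma pcbrtK (k : closedFieldType) (p : {poly k}) :
  3%:R = 0 :> k -> p^`() = 0 -> pcbrt p ^+ 3 = p.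
Proof.
move=> k3 dp0; apply/polyP=> i; rewrite coef_cube // coef_poly.
case: ifPn => [/dvdnP[j ->]|n3i].
  rewrite mulnK // mulnC; case: ltnP => [_|le_pj]; first exact: cbrtK.
  by rewrite expr0n nth_default ?(leq_trans le_pj) ?leq_pmulr.
case: i n3i => // i n3i; have := coef_deriv p i.
rewrite dp0 coef0 => /esym/eqP; rewrite -mulr_natr mulf_eq0 => /orP[/eqP->//|].
have ch3 : 3%N \in [pchar k] by rewrite inE /= k3 eqxx.
by rewrite -(dvdn_pcharf ch3) (negPf n3i).
Qed.

(** * Linearising the group law: u = x/y and v = 1/y *)

Lemma expand_fraction (F : fieldType) (x y d e : F) : d != 0 -> e != 0 ->
  x * d = y -> x = y * e / (e * d).
Proof. by move=> d0 e0 <-; field; rewrite d0 e0. Qed.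

Section Chart.
Variables (K : fieldType) (b : K).

Definition uv_solution (w : K * K) : bool := w.1 ^+ 3 == w.2 - b * w.2 ^+ 3.

(** The zero section is the point [u = v = 0], and it is the only solution with
    [v = 0]. *)
Definition uv_point (w : K * K) : wpoint K :=
  if w.2 == 0 then None else Some (w.1 / w.2, w.2^-1).

Lemma uv_solution0 (u v : K) : uv_solution (u, v) -> v = 0 -> u = 0.
Proof.
rewrite /uv_solution /= => /eqP uvE v0.
by move/eqP: uvE; rewrite v0 expr0n mulr0 subrr expf_eq0 => /eqP.
Qed.

(** If [b], [w] and [d] are polynomials, then [u * d] has a polynomial cube; this
    is how [u] is shown to have the same denominator as [v]. *)
Lemma uv_solution_frac (u w d : K) : d != 0 ->
  uv_solution (u, w / d) = ((u * d) ^+ 3 == w * d ^+ 2 - b * w ^+ 3).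
Proof.
move=> d0; rewrite /uv_solution /=.
rewrite -[LHS](inj_eq (mulIf (expf_neq0 3 d0))) exprMn.
by congr (_ == _); field.
Qed.

Lemma on_cubic_uv_point w : uv_solution w -> on_cubic b (uv_point w).
Proof.
case: w => u v; rewrite /uv_solution /uv_point /= => /eqP uvE.
by case: eqP => //= /eqP v0; rewrite expr_div_n uvE; apply/eqP; field.
Qed.

(** A point with [y = 0] has no coordinates [u], [v]; such a point would make
    [- b] a cube. *)
Lemma uv_point_onto P : (forall z : K, z ^+ 3 != - b) -> on_cubic b P ->
  exists2 w, uv_solution w & uv_point w = P.
Proof.
move=> ncube; case: P => [[x y]|] /= => [/eqP PE|_]; last first.
  by exists (0, 0); rewrite /uv_solution /uv_point /= ?eqxx //
     !expr0n mulr0 subrr.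
have y0 : y != 0.
  apply/eqP=> y0; case/eqP: (ncube x); apply/eqP; rewrite -addr_eq0.
  by rewrite -PE y0 expr0n.
exists (x / y, y^-1); rewrite /uv_solution /uv_point /=.
  have bE : b = y ^+ 2 - x ^+ 3 by rewrite PE; ring.
  by apply/eqP; rewrite bE; field.
by rewrite invr_eq0 (negPf y0) invrK divfK.
Qed.

Lemma uv_point_inj w1 w2 : uv_solution w1 -> uv_solution w2 ->
  uv_point w1 = uv_point w2 -> w1 = w2.
Proof.
case: w1 w2 => u v [u' v'] Huv Huv'; rewrite /uv_point /=.
case: eqP => v0; case: eqP => v0' //.
  by rewrite v0 v0' (uv_solution0 Huv v0) (uv_solution0 Huv' v0').
case=> uu' /invr_inj vv'; rewrite -{}vv' {v0'} in uu' *.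
by move/eqP: v0 uu' => v0 /(mulIf (invr_neq0 v0)) ->.
Qed.

(** In the chart the cubic is [u^3 = v - b v^3], on which three points of a line
    [v = l u + m] have [v]-coordinates of sum zero, since
    [(v - m)^3 = l^3 (v - b v^3)] has no term in [v^2] in characteristic 3.
    The computation is done in [x], [y]: subtracting the two equations gives
    [(y2 - y1) (y1 + y2) = (x2 - x1)^3], so that the slope is also
    [(x2 - x1)^2 / (y1 + y2)].  For the tangent the slope vanishes, in
    agreement with [2 P = - P]. *)
Lemma uv_point_chord (x1 y1 x2 y2 : K) : 3%:R = 0 :> K ->
  y1 != 0 -> y2 != 0 -> y1 ^+ 2 = x1 ^+ 3 + b -> y2 ^+ 2 = x2 ^+ 3 + b ->
  uv_point (x1 / y1 + x2 / y2, y1^-1 + y2^-1)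
    = wadd (Some (x1, y1)) (Some (x2, y2)).
Proof.
move=> K3 y1n0 y2n0 E1 E2; rewrite /uv_point /=.
have sumV : y1^-1 + y2^-1 = (y1 + y2) / (y1 * y2).
  by field; rewrite y1n0 y2n0.
have sumVE : (y1^-1 + y2^-1 == 0) = (y1 == - y2).
  by rewrite sumV mulf_eq0 invr_eq0 mulf_eq0 (negPf y1n0) (negPf y2n0) /= orbF
     addr_eq0.
have cubeE : (y2 - y1) * (y1 + y2) = (x2 - x1) ^+ 3.
  have -> : (y2 - y1) * (y1 + y2) = y2 ^+ 2 - y1 ^+ 2 by ring.
  by rewrite cubeB // E1 E2; ring.
rewrite sumVE; have [xE|xN] := eqVneq x1 x2; last first.
  have sN0 : y1 + y2 != 0.
    apply: contraNneq xN => s0; move/eqP: cubeE.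
    by rewrite s0 mulr0 eq_sym expf_eq0 subr_eq0 eq_sym.
  have dN0 : x2 - x1 != 0 by rewrite subr_eq0 eq_sym.
  rewrite -addr_eq0 (negPf sN0) /=.
  set l := (y2 - y1) / (x2 - x1).
  have lE : l = (x2 - x1) ^+ 2 / (y1 + y2).
    apply: (mulIf sN0); apply: (mulIf dN0); rewrite divfK //.
    by rewrite -exprSr -cubeE /l; field.
  have l2E : l ^+ 2 = (y2 - y1) * (x2 - x1) / (y1 + y2).
    by rewrite expr2 {1}lE /l; field; rewrite sN0.
  have x3E : l ^+ 2 - x1 - x2 = (y2 * x1 + y1 * x2) / (y1 + y2).
    apply: (mulIf sN0); rewrite divfK // l2E.
    have -> : ((y2 - y1) * (x2 - x1) / (y1 + y2) - x1 - x2) * (y1 + y2) =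
      (y2 - y1) * (x2 - x1) - (x1 + x2) * (y1 + y2) by field.
    ring3 K3.
  have y3E : l * (x1 - (l ^+ 2 - x1 - x2)) - y1 = y1 * y2 / (y1 + y2).
    have -> : x1 - (l ^+ 2 - x1 - x2) = - (y1 * (x2 - x1)) / (y1 + y2).
      by rewrite x3E; field.
    apply: (mulIf sN0); rewrite /l.
    have -> : ((y2 - y1) / (x2 - x1) * (- (y1 * (x2 - x1)) / (y1 + y2)) - y1) *
      (y1 + y2) = - y1 * (y2 + y2) by field; rewrite ?dN0 ?sN0.
    rewrite divfK //; ring3 K3.
  by rewrite y3E x3E sumV; congr (Some (_, _)); field; rewrite ?sN0 ?y1n0 ?y2n0.
rewrite -xE in E2 cubeE *.
case: eqP => //= y12.
have /eqP : (y2 - y1) * (y1 + y2) = 0 by rewrite cubeE subrr expr0n.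
rewrite mulf_eq0 subr_eq0 addr_eq0 => /orP[/eqP->|/eqP//].
have dbl (z : K) : z + z = - z by ring3 K3.
rewrite K3 !mul0r expr0n sub0r !dbl.
by rewrite opprK sub0r invrN invrK mulrNN divfK.
Qed.

Lemma uv_pointD (u1 v1 u2 v2 : K) : 3%:R = 0 :> K ->
  uv_solution (u1, v1) -> uv_solution (u2, v2) ->
  uv_point (u1 + u2, v1 + v2) = wadd (uv_point (u1, v1)) (uv_point (u2, v2)).
Proof.
move=> K3 Hw1 Hw2.
have u1_0 := uv_solution0 Hw1; have u2_0 := uv_solution0 Hw2.
have := on_cubic_uv_point Hw1; have := on_cubic_uv_point Hw2.
rewrite /uv_point /=.
have [v1_0|v1n0] := eqVneq v1 0.
  by rewrite v1_0 u1_0 // !add0r; case: eqP.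
have [v2_0|v2n0] := eqVneq v2 0.
  by rewrite v2_0 u2_0 // !addr0 (negPf v1n0).
move=> /eqP E2 /eqP E1.
by rewrite -uv_point_chord ?invr_eq0 // !invrK !divfK.
Qed.
End Chart.

(** * Finite groups of exponent 3 *)

Section ElementaryAbelian.
Variables (M : zmodType) (A : pred M).
Hypotheses (A_zmod : zmod_closed A) (A3 : forall x, x \in A -> x *+ 3 = 0).

Definition Z3_embedding (r : nat) (g : 'rV['Z_3]_r -> M) : Prop :=
  [/\ injective g, forall v, g v \in A & forall v w, g (v + w) = g v + g w].

Lemma mulrnZ3D (x : M) (a b : 'Z_3) : x \in A ->
  x *+ (a + b)%R = x *+ a + x *+ b.
Proof.
move=> Ax; rewrite -mulrnDr /= [in RHS](divn_eq (a + b)%N 3).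
by rewrite mulrnDr mulrnA mulrnAC A3 // mul0rn add0r.
Qed.

(** As 3 is prime, an element [x] outside a subgroup generates a complement of
    order 3: if [a x] is in the subgroup with [a = 1] or [2], then so is [x] up
    to sign. *)
Lemma Z3_embedding_extend (r : nat) (g : 'rV['Z_3]_r -> M) (x : M) :
  Z3_embedding g -> x \in A -> x \notin codom g ->
  exists g' : 'rV['Z_3]_(1 + r) -> M, Z3_embedding g'.
Proof.
move=> [g_inj gA gD] Ax xNg.
have [A0 AB] := A_zmod; have [_ AD] := GRing.zmod_closedD A_zmod.
have g0 : g 0 = 0 by apply: (addrI (g 0)); rewrite -gD !addr0.
have gN v : g (- v) = - g v.
  by apply: (addrI (g v)); rewrite -gD !subrr.
have Amul n : x *+ n \in A by elim: n => [//|n IHn]; rewrite mulrS AD.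
pose g' (v : 'rV['Z_3]_(1 + r)) := x *+ (lsubmx v 0 0) + g (rsubmx v).
have g'D v w : g' (v + w) = g' v + g' w.
  by rewrite /g' !linearD gD mxE mulrnZ3D // addrACA.
have g'N v : g' (- v) = - g' v.
  apply: (addrI (g' v)); rewrite -g'D !subrr /g' !linear0 mxE g0 mulr0n.
  exact: addr0.
have ker0 v : g' v = 0 -> v = 0.
  rewrite -[v]hsubmxK [lsubmx v]mx11_scalar /g' row_mxKl row_mxKr mxE mulr1n.
  move: (lsubmx v 0 0) (rsubmx v) => a w.
  have xN : (forall w, g w <> x).
    by move=> w' e; rewrite -e codom_f in xNg.
  case: a => [[|[|[|//]]] lt_a] /= gx0.
  - rewrite add0r -g0 in gx0; rewrite (g_inj _ _ gx0).
    rewrite [Ordinal _](_ : _ = 0); last exact: val_inj.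
    by rewrite (raddf0 (@scalar_mx _ 1)) row_mx0.
  - case: (xN (- w)); rewrite gN.
    by apply/eqP; rewrite eq_sym -addr_eq0 gx0.
  - case: (xN w); apply: (addrI (x *+ 2)).
    by rewrite gx0 -mulrSr A3.
exists g'; split=> [v w e|v|//]; last exact: AD.
by apply/eqP; rewrite -subr_eq0; apply/eqP/ker0; rewrite g'D g'N e subrr.
Qed.

Lemma Z3_embedding_card (s : seq M) (r : nat) (g : 'rV['Z_3]_r -> M) :
  {subset A <= s} -> Z3_embedding g -> (r < size s)%N.
Proof.
move=> As [g_inj gA _].
apply: (@leq_trans (size (codom g))); last first.
  apply: uniq_leq_size; first by rewrite map_inj_uniq ?enum_uniq.
  by move=> _ /codomP[v ->]; apply: As.
by rewrite size_codom card_mx mul1n card_ord ltn_expl.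
Qed.

(** Embeddings of [(Z/3)^r] are extended as long as they miss an element; their
    cardinality bounds [r]. *)
Lemma finite_exponent3_isog (s : seq M) :
  {subset A <= s} -> exists r, isog_Z3 A +%R r.
Proof.
move=> As.
have [A0 _] := A_zmod.
(* [n] is the number of extensions that the size of [s] still allows. *)
have grow n r (g : 'rV['Z_3]_r -> M) : (size s <= r + n)%N ->
    Z3_embedding g -> exists r, isog_Z3 A +%R r.
  elim: n r g => [|n IHn] r g le_s g_emb.
    by have := Z3_embedding_card As g_emb; rewrite ltnNge -[r]addn0 le_s.
  have [g_inj gA gD] := g_emb.
  have [/hasP[x _ /andP[Ax xNg]]|full] :=
      boolP (has (fun x => (x \in A) && (x \notin codom g)) s).
    have [g' g'_emb] := Z3_embedding_extend g_emb Ax xNg.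
    by apply: IHn g'_emb; rewrite add1n addSnnS.
  exists r, g; split=> // P; split=> [AP|[v <-]]; last exact: gA.
  have := hasPn full P (As _ AP).
  by rewrite negb_and [P \in A]AP negbK => /codomP[v ->]; exists v.
apply: (grow (size s) 0%N (fun _ => 0)); first by [].
split=> [v w _||]; first by rewrite !thinmx0.
  by [].
by move=> v w; rewrite addr0.
Qed.
End ElementaryAbelian.

(** * Sections as polynomial solutions of a differential equation *)

Local Open Scope quotient_scope.

Lemma tofrac_repr (R : idomainType) (x : {fraction R}) :
  exists2 nd : R * R, nd.2 != 0 & x = tofrac nd.1 / tofrac nd.2.
Proof.
elim/quotW: x => -[[n d] /= d0]; exists (n, d) => //=.
rewrite -[RHS]/(FracField.mul (FracField.tofrac n)
                  (FracField.inv (FracField.tofrac d))) !piE.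
congr (\pi _); rewrite /FracField.mulf /FracField.invf !numden_Ratio ?oner_eq0 //.
by rewrite mulr1 mul1r -[LHS]FracField.Ratio_numden.
Qed.

Local Close Scope quotient_scope.

Lemma coprime_repr (k : fieldType) (x : {fraction {poly k}}) :
  exists n d : {poly k}, [/\ d != 0, coprimep n d & x = tofrac n / tofrac d].
Proof.
have [[m e] /= e0 ->] := tofrac_repr x.
exists (m %/ gcdp m e), (e %/ gcdp m e).
have g0 : gcdp m e != 0 by rewrite gcdp_eq0 negb_and e0 orbT.
have mE := divpK (dvdp_gcdl m e); have eE := divpK (dvdp_gcdr m e).
have d0 : e %/ gcdp m e != 0.
  by apply: contraNneq e0 => d0; rewrite -eE d0 mul0r.
split=> //.
  by rewrite coprimep_div_gcd // e0 orbT.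
apply/eqP; rewrite eqr_div ?tofrac_eq0 // -!tofracM tofrac_eq.
by apply/eqP/(mulIf g0); rewrite -mulrA eE mulrAC mE.
Qed.

(** Polynomials are integrally closed in [k(t)]; for cubes it is enough that
    [e ^+ 3 %| m ^+ 3] implies [e %| m]. *)
Lemma cube_poly_frac (k : fieldType) (x : {fraction {poly k}}) (p : {poly k}) :
  x ^+ 3 = tofrac p -> exists2 q, x = tofrac q & q ^+ 3 = p.
Proof.
have [m [e [e0 _ ->]]] := coprime_repr x.
have eF0 : tofrac e != 0 by rewrite tofrac_eq0.
rewrite expr_div_n => /eqP; rewrite -[tofrac p]divr1 eqr_div ?oner_eq0 ?expf_neq0 //.
rewrite mulr1 -!tofracXn -tofracM tofrac_eq => /eqP mE.
have /dvdpP[q qE] : e %| m.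
  by rewrite -(dvdp_pexp2r _ _ (isT : (0 < 3)%N)) mE dvdp_mull.
exists q; first by rewrite qE tofracM mulfK.
apply: (mulIf (expf_neq0 3 e0)); rewrite -exprMn -qE mE //.
Qed.

Section Sections.
Variables (k : closedFieldType) (k3 : 3%:R = 0 :> k) (a : {poly k}).
Hypothesis da0 : a^`() != 0.
Let K := {fraction {poly k}}.
Let kX3 : 3%:R = 0 :> {poly k} := poly_char3 k3.

Lemma frac_char3 : 3%:R = 0 :> K.
Proof. by rewrite -(rmorph_nat (@tofrac {poly k})) kX3 rmorph0. Qed.

(** This is [v' = a' v^3] for [v = w / a']. *)
Definition numerator_eq (w : {poly k}) : Prop :=
  w^`() * a^`() - w * a^`()^`() = w ^+ 3.

(** [(v - a v^3) a'^3] for [v = w / a'], which has to be the cube of [u a']. *)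
Definition residual (w : {poly k}) : {poly k} :=
  w * a^`() ^+ 2 - a * w ^+ 3.

Lemma deriv_residual w :
  (residual w)^`() = a^`() * (w^`() * a^`() - w * a^`()^`() - w ^+ 3).
Proof.
by rewrite /residual !derivE; ring3 kX3.
Qed.

Lemma deriv_cube (p : {poly k}) : (p ^+ 3)^`() = 0.
Proof. rewrite !derivE; ring3 kX3. Qed.

Lemma numerator_eqP w : numerator_eq w <-> exists q, q ^+ 3 = residual w.
Proof.
split=> [w_eq|[q qE]].
  exists (pcbrt (residual w)); apply: pcbrtK => //.
  by rewrite deriv_residual w_eq subrr mulr0.
have /eqP := deriv_residual w; rewrite -qE deriv_cube eq_sym mulf_eq0 (negPf da0).
by rewrite subr_eq0 => /eqP.
Qed.

Lemma uv_solution_numerators (q w : {poly k}) :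
  uv_solution (tofrac a) (tofrac q / tofrac a^`(), tofrac w / tofrac a^`())
    = (q ^+ 3 == residual w).
Proof.
rewrite uv_solution_frac ?tofrac_eq0 // divfK ?tofrac_eq0 // /residual.
rewrite -[RHS]tofrac_eq tofracB.
by rewrite !(tofracM _ (_ ^+ _)) !tofracXn.
Qed.

(** For [v = n/d] in lowest terms, [m = u d] satisfies [m^3 = n d^2 - a n^3] and
    is a polynomial.  Differentiating,
    [a' n^3 = d (n' d + 2 n d')], and [d] is prime to [n], so [d] divides [a']:
    poles of [v] occur only at zeros of [a'], with at most their
    multiplicity. *)
Lemma uv_solution_denominator (u v : K) : uv_solution (tofrac a) (u, v) ->
  exists q w : {poly k}, u = tofrac q / tofrac a^`() /\ v = tofrac w / tofrac a^`().
Proof.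
have [n [d [d0 cop ->]]] := coprime_repr v.
have D0 : tofrac d != 0 by rewrite tofrac_eq0.
have A0 : tofrac a^`() != 0 by rewrite tofrac_eq0.
rewrite (uv_solution_frac _ _ _ D0) => /eqP uE.
have : (u * tofrac d) ^+ 3 = tofrac (n * d ^+ 2 - a * n ^+ 3).
  by rewrite uE tofracB !(tofracM _ (_ ^+ _)) !tofracXn.
case/cube_poly_frac=> m umE mE.
have /dvdpP[e eE] : d %| a^`().
  have -> : d %| a^`() = (d %| a^`() * n ^+ 3).
    by rewrite Gauss_dvdpl // coprimep_expr // coprimep_sym.
  have := deriv_cube m; rewrite mE !derivE => dE.
  apply/dvdpP; exists (n^`() * d + n * d^`() *+ 2).
  apply/subr0_eq; rewrite -oppr0 -dE; ring3 kX3.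
have e0 : tofrac e != 0.
  by apply: contraNneq A0 => e0; rewrite eE tofracM e0 mul0r.
exists (m * e), (n * e); rewrite eE !tofracM.
split.
  exact: expand_fraction D0 e0 umE.
exact: expand_fraction D0 e0 (divfK D0 _).
Qed.

(** [u] is the cube root of [v - a v^3], so the section depends on [w] only. *)
Definition numerator_section (w : {poly k}) : wpoint K :=
  uv_point (tofrac (pcbrt (residual w)) / tofrac a^`(), tofrac w / tofrac a^`()).

Lemma not_cube (z : K) : z ^+ 3 != - tofrac a.
Proof.
rewrite -tofracN; apply/eqP => /cube_poly_frac[q _ /(congr1 (@deriv k))].
by rewrite deriv_cube derivN => /esym/eqP; rewrite oppr_eq0 (negPf da0).
Qed.

Lemma numerator_eq_residual w : numerator_eq w ->
  pcbrt (residual w) ^+ 3 = residual w.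
Proof.
move=> w_eq; apply: pcbrtK => //.
by rewrite deriv_residual w_eq subrr mulr0.
Qed.

Lemma numerator_eq_uv w : numerator_eq w ->
  uv_solution (tofrac a) (tofrac (pcbrt (residual w)) / tofrac a^`(),
                          tofrac w / tofrac a^`()).
Proof.
by move=> /numerator_eq_residual wE; rewrite uv_solution_numerators wE.
Qed.

Lemma numerator_section_MW w : numerator_eq w -> MW a (numerator_section w).
Proof. by move=> /numerator_eq_uv; apply: on_cubic_uv_point. Qed.

Lemma numerator_section_onto P : MW a P ->
  exists2 w, numerator_eq w & numerator_section w = P.
Proof.
move=> /(uv_point_onto not_cube)[[u v] uv_sol <-].
have [q [w [uE vE]]] := uv_solution_denominator uv_sol.
move: uv_sol; rewrite uE vE uv_solution_numerators => /eqP qE.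
have w_eq : numerator_eq w by apply/numerator_eqP; exists q.
exists w; first exact: w_eq.
rewrite /numerator_section.
have -> : pcbrt (residual w) = q; last by [].
by apply: (cube_inj kX3); rewrite /= numerator_eq_residual.
Qed.

Lemma numerator_section_inj w1 w2 : numerator_eq w1 -> numerator_eq w2 ->
  numerator_section w1 = numerator_section w2 -> w1 = w2.
Proof.
have A0 : (tofrac a^`())^-1 != 0 by rewrite invr_eq0 tofrac_eq0.
move=> /numerator_eq_uv sol1 /numerator_eq_uv sol2 /(uv_point_inj sol1 sol2).
by case=> _ /(mulIf A0)/eqP; rewrite tofrac_eq => /eqP.
Qed.

(** [residual] is additive because it is linear in [w] and [w^3]; so is its cube
    root, by injectivity of Frobenius. *)
Lemma numerator_sectionD w1 w2 : numerator_eq w1 -> numerator_eq w2 ->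
  numerator_section (w1 + w2) = wadd (numerator_section w1) (numerator_section w2).
Proof.
move=> w1_eq w2_eq; rewrite /numerator_section.
rewrite -(uv_pointD frac_char3 (numerator_eq_uv w1_eq) (numerator_eq_uv w2_eq)).
have [E1 E2] := (numerator_eq_residual w1_eq, numerator_eq_residual w2_eq).
rewrite -!mulrDl -!tofracD.
have -> : pcbrt (residual (w1 + w2)) = pcbrt (residual w1) + pcbrt (residual w2);
  last by [].
have resD : residual (w1 + w2) = residual w1 + residual w2.
  by rewrite /residual cubeD //; ring.
apply: (cube_inj kX3); rewrite /= cubeD // E1 E2 -resD.
by apply: pcbrtK => //; rewrite resD -E1 -E2 derivD !deriv_cube addr0.
Qed.
End Sections.

(** * The coefficients of the differential equation *)

Section System.
Variables (k : closedFieldType) (k3 : 3%:R = 0 :> k) (a4 a5 a7 a8 : k).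
Let kX3 : 3%:R = 0 :> {poly k} := poly_char3 k3.
Local Notation a := (a12 a4 a5 a7 a8).
Local Notation S := (solutions a4 a5 a7 a8).

Definition a12_deriv : {poly k} :=
  'X^9 - (a8 ^+ 3)%:P * 'X^7 + (a7 ^+ 3)%:P * 'X^6 - (a5 ^+ 3)%:P * 'X^4
  + (a4 ^+ 3)%:P * 'X^3 - 'X.

Lemma a12_derivE : a^`() = a12_deriv.
Proof.
rewrite /a12 /a12_deriv !derivE -!mul_polyC; ring3 kX3.
Qed.

Lemma a12_deriv2E : a^`()^`() =
  - (a8 ^+ 3)%:P * 'X^6 - (a5 ^+ 3)%:P * 'X^3 - 1.
Proof.
rewrite a12_derivE /a12_deriv !derivE; ring3 kX3.
Qed.

(** The coefficients, by increasing degree from 0 to 12, of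
    [w' a' - w a'' - w^3] for [w = w0 + w1 t + w2 t^2 + w3 t^3 + w4 t^4].  In the
    degrees that are not multiples of 3 only [w2] survives. *)
Definition numerator_defect (w0 w1 w2 w3 w4 : k) : seq k :=
  [:: w0 - w0 ^+ 3; 0; - w2;
      w1 * a4 ^+ 3 + w0 * a5 ^+ 3 + w3 - w1 ^+ 3; - (w2 * a4 ^+ 3);
      - (w2 * a5 ^+ 3);
      w1 * a7 ^+ 3 + w4 * a4 ^+ 3 + w0 * a8 ^+ 3 + w3 * a5 ^+ 3 - w2 ^+ 3;
      - (w2 * a7 ^+ 3); - (w2 * a8 ^+ 3);
      w1 + w4 * a7 ^+ 3 + w3 * a8 ^+ 3 - w3 ^+ 3; - w2; 0; w4 - w4 ^+ 3].

Lemma Poly_cons (c : k) s : Poly (c :: s) = Poly s * 'X + c%:P.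
Proof. by rewrite /= cons_poly_def. Qed.

Lemma numerator_defectE w0 w1 w2 w3 w4 (w := Poly [:: w0; w1; w2; w3; w4]) :
  w^`() * a^`() - w * a^`()^`() - w ^+ 3 = Poly (numerator_defect w0 w1 w2 w3 w4).
Proof.
rewrite a12_deriv2E a12_derivE /a12_deriv /w /numerator_defect !Poly_cons [Poly [::]]/=.
rewrite !derivE; ring3 kX3.
Qed.

Lemma a12_deriv_neq0 : a^`() != 0.
Proof.
rewrite a12_derivE; apply/eqP => /(congr1 (fun p : {poly k} => p`_1)).
rewrite /a12_deriv !coefE /= => /eqP.
by rewrite !mulr0 !(addr0, subr0, add0r, sub0r, oppr0) oppr_eq0 oner_eq0.
Qed.

Lemma size_a12_deriv : (size a^`() <= 10)%N.
Proof.
apply/leq_sizeP=> j j10; rewrite a12_derivE /a12_deriv !coefE.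
by do 10?[case: j j10 => // j j10]; rewrite /= !mulr0 !(addr0, subr0).
Qed.

(** [deg w^3 <= deg w + 8], hence [2 deg w <= 8]. *)
Lemma size_numerator w : numerator_eq a w -> (size w <= 5)%N.
Proof.
move=> w_eq; have [->|w0] := eqVneq w 0; first by rewrite size_poly0.
have s3 : size (w ^+ 3) = ((size w).-1 * 3).+1.
    by rewrite -size_exp prednK // size_poly_gt0 expf_neq0.
have : (size (w ^+ 3) <= size w + 8)%N.
  rewrite -w_eq; apply: leq_trans (size_polyD _ _) _.
  rewrite size_polyN geq_max; apply/andP; split.
    apply: leq_trans (size_polyMleq _ _) _.
    have := size_a12_deriv; have := lt_size_deriv w0.
    move: (size w^`()) (size a^`()) (size w) => x y z. lia.
  apply: leq_trans (size_polyMleq _ _) _.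
  have := size_a12_deriv; have := lt_size_deriv a12_deriv_neq0.
  move: (size w) (size a^`()) (size a^`()^`()) => x y z. lia.
rewrite s3; move: (size w) => x; lia.
Qed.

(** The coefficients of [t] and [t^3] are written as cubes so that the equations
    below become cubes of equations in the [c_i]; [c0] and [c3] are their own
    cubes. *)
Definition numerator_of (c : 'rV[k]_4) : {poly k} :=
  Poly [:: c 0 0; c 0 2%:R ^+ 3; 0; c 0 1 ^+ 3; c 0 3%:R].

Lemma numerator_ofD c d : numerator_of (c + d) = numerator_of c + numerator_of d.
Proof.
rewrite /numerator_of !Poly_cons !mxE [Poly [::]]/=; ring3 kX3.
Qed.

Lemma numerator_of_inj : injective numerator_of.
Proof.
move=> c d /polyP E; apply/rowP=> i.
have := E 0%N; have := E 1%N; have := E 3%N; have := E 4%N.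
rewrite !coef_Poly /= => E4 /(cube_inj k3) E3 /(cube_inj k3) E1 E0.
case: i => [[|[|[|[|//]]]] lt_i].
- by rewrite (_ : Ordinal _ = 0) //; apply: val_inj.
- by rewrite (_ : Ordinal _ = 1) //; apply: val_inj.
- by rewrite (_ : Ordinal _ = 2%:R) //; apply: val_inj.
- by rewrite (_ : Ordinal _ = 3%:R) //; apply: val_inj.
Qed.

Lemma numerator_of_onto w0 w1 w3 w4 : exists c : 'rV[k]_4,
  Poly [:: w0; w1; 0; w3; w4] = numerator_of c.
Proof.
exists (\row_i [:: w0; cbrt w3; cbrt w1; w4]`_i).
by rewrite /numerator_of !mxE /= !cbrtK.
Qed.

(** The coefficients of degree 3, 6 and 9 are the cubes of [x], [y], [z].
    The third and fifth equations of the system are [x = 0] and [y = 0], and the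
    fourth one is [z = 0] after elimination of [c1] by the third. *)
Lemma numerator_of_solution c : S c <-> numerator_eq a (numerator_of c).
Proof.
rewrite /solutions.
set c0 := c 0 0; set c1 := c 0 1; set c2 := c 0 2%:R; set c3 := c 0 3%:R.
pose x := c1 - (c2 ^+ 3 - a4 * c2 - a5 * c0).
pose y := a8 * c0 + a5 * c1 + a7 * c2 + a4 * c3.
pose z := c2 + a7 * c3 + a8 * c1 - c1 ^+ 3.
have defectE : c0 = c0 ^+ 3 -> c3 = c3 ^+ 3 ->
    numerator_defect c0 (c2 ^+ 3) 0 (c1 ^+ 3) c3
      = [:: 0; 0; 0; x ^+ 3; 0; 0; y ^+ 3; 0; 0; z ^+ 3; 0; 0; 0].
  move=> h0 h3.
  have xE : x ^+ 3 = c2 ^+ 3 * a4 ^+ 3 + c0 ^+ 3 * a5 ^+ 3 + c1 ^+ 3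
      - (c2 ^+ 3) ^+ 3 by rewrite /x; ring3 k3.
  have yE : y ^+ 3 = c2 ^+ 3 * a7 ^+ 3 + c3 ^+ 3 * a4 ^+ 3 + c0 ^+ 3 * a8 ^+ 3
      + c1 ^+ 3 * a5 ^+ 3 by rewrite /y; ring3 k3.
  have zE : z ^+ 3 = c2 ^+ 3 + c3 ^+ 3 * a7 ^+ 3 + c1 ^+ 3 * a8 ^+ 3
      - (c1 ^+ 3) ^+ 3 by rewrite /z; ring3 k3.
  rewrite xE yE zE -h0 -h3 /numerator_defect -h0 -h3.
  by rewrite expr0n /= !mul0r !subrr !oppr0 !addr0.
have systemE : c0 = c0 ^+ 3 -> c1 = c2 ^+ 3 - a4 * c2 - a5 * c0 ->
    c2 ^+ 9 - (a4 ^+ 3 + a8) * c2 ^+ 3 + (a4 * a8 - 1) * c2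
      + (a8 * a5 - a5 ^+ 3) * c0 - a7 * c3 = - z.
  move=> h0 h1; rewrite /z [c1 in RHS]h1 [_ * c0]mulrBl {2}h0.
  by ring3 k3.
have eqE : numerator_eq a (numerator_of c) <->
    Poly (numerator_defect c0 (c2 ^+ 3) 0 (c1 ^+ 3) c3) = 0.
  rewrite -numerator_defectE /numerator_eq /numerator_of.
  by split=> [->|/subr0_eq//]; rewrite subrr.
apply: (iff_trans _ (iff_sym eqE)); split.
  case/and5P=> /eqP h0 /eqP h3 /eqP h1 h2 /eqP h4.
  have x0 : x = 0 by rewrite /x h1 subrr.
  have z0 : z = 0 by apply/eqP; rewrite -oppr_eq0 -(systemE h0 h1).
  rewrite (defectE h0 h3) x0 [y]h4 z0 expr0n.
  by rewrite /= !cons_poly_def !(mul0r, addr0).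
move=> /polyP E.
have h0 : c0 = c0 ^+ 3.
  by apply/subr0_eq; have := E 0%N; rewrite coef_Poly coef0.
have h3 : c3 = c3 ^+ 3.
  by apply/subr0_eq; have := E 12; rewrite coef_Poly coef0.
have cube0 (t : k) : t ^+ 3 = 0 -> t = 0.
  by move/eqP; rewrite expf_eq0 => /eqP.
move: E; rewrite (defectE h0 h3) => E.
have x0 : x = 0 by apply: cube0; have := E 3%N; rewrite coef_Poly coef0.
have y0 : y = 0 by apply: cube0; have := E 6%N; rewrite coef_Poly coef0.
have z0 : z = 0 by apply: cube0; have := E 9%N; rewrite coef_Poly coef0.
have h1 := subr0_eq x0.
apply/and5P; split; [exact/eqP..| |exact/eqP].
by rewrite (systemE h0 h1) z0 oppr0.
Qed.

(** The coefficient of degree 2 of the equation is [- w2]. *)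
Lemma numerator_eq_of w : numerator_eq a w -> exists c, numerator_of c = w.
Proof.
move=> w_eq; have sw := size_numerator w_eq.
have wE : w = Poly [:: w`_0; w`_1; w`_2; w`_3; w`_4].
  apply/polyP=> i; rewrite coef_Poly; case: i => [|[|[|[|[|i]]]]] //=.
  by rewrite !nth_default // (leq_trans sw).
have w2 : w`_2 = 0.
  have := coef_Poly (numerator_defect w`_0 w`_1 w`_2 w`_3 w`_4) 2.
  rewrite -numerator_defectE -wE w_eq subrr coef0 => /esym/eqP.
  by rewrite oppr_eq0 => /eqP.
rewrite wE w2; have [c ->] := numerator_of_onto w`_0 w`_1 w`_3 w`_4.
by exists c.
Qed.

Lemma numerator_eqB w1 w2 : numerator_eq a w1 -> numerator_eq a w2 ->
  numerator_eq a (w1 - w2).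
Proof.
rewrite /numerator_eq derivB cubeB // => <- <-; ring.
Qed.

Lemma solutions_zmod_closed : zmod_closed S.
Proof.
split.
  apply/numerator_of_solution; rewrite (_ : numerator_of 0 = 0).
    by rewrite /numerator_eq deriv0 !mul0r subrr expr0n.
  by apply: (addrI (numerator_of 0)); rewrite -numerator_ofD !addr0.
move=> c d /numerator_of_solution Sc /numerator_of_solution Sd.
apply/numerator_of_solution.
have -> : numerator_of (c - d) = numerator_of c - numerator_of d.
  by apply: (addIr (numerator_of d)); rewrite -numerator_ofD !subrK.
exact: numerator_eqB.
Qed.

Definition root_seq (p : {poly k}) : seq k := sval (closed_field_poly_normal p).

Lemma mem_root_seq (p : {poly k}) (x : k) : p != 0 -> root p x -> x \in root_seq p.
Proof.
move=> p0; rewrite /root_seq; case: closed_field_poly_normal => s /= pE.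
by rewrite {1}pE rootZ ?lead_coef_eq0 // root_prod_XsubC.
Qed.

(** The fourth equation is monic in [c2], and its other unknowns [c0] and [c3]
    lie in the prime field. *)
Lemma solutions_finite : exists s : seq 'rV[k]_4, {subset S <= s}.
Proof.
pose p1 : {poly k} := 'X^3 - 'X.
pose p2 (c0 c3 : k) : {poly k} :=
  'X^9 - (a4 ^+ 3 + a8)%:P * 'X^3 + (a4 * a8 - 1)%:P * 'X
  + ((a8 * a5 - a5 ^+ 3) * c0 - a7 * c3)%:P.
have p1_neq0 : p1 != 0.
  apply/eqP=> /(congr1 (fun p : {poly k} => p`_3)) /eqP.
  by rewrite /p1 !coefE /= subr0 oner_eq0.
have p2_neq0 c0 c3 : p2 c0 c3 != 0.
  apply/eqP=> /(congr1 (fun p : {poly k} => p`_9)) /eqP.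
  by rewrite /p2 !coefE /= !mulr0 subr0 !addr0 oner_eq0.
pose sol (c0 c3 c2 : k) : 'rV[k]_4 :=
  \row_i [:: c0; c2 ^+ 3 - a4 * c2 - a5 * c0; c2; c3]`_i.
exists (flatten [seq [seq sol cc.1 cc.2 c2 | c2 <- root_seq (p2 cc.1 cc.2)]
                | cc <- [seq (c0, c3) | c0 <- root_seq p1, c3 <- root_seq p1]]).
move=> c; rewrite unfold_in => /and5P[/eqP h0 /eqP h3 /eqP h1 /eqP h2 _].
apply/flatten_mapP; exists (c 0 0, c 0 3%:R).
  by apply: allpairs_f; apply: mem_root_seq => //;
    rewrite /root /p1 !hornerE subr_eq0 eq_sym; apply/eqP.
apply/mapP; exists (c 0 2%:R).
  apply: mem_root_seq => //; rewrite /root /p2 !hornerE /=.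
  by rewrite -h2; apply/eqP; ring.
apply/rowP=> i; rewrite mxE; case: i => [[|[|[|[|//]]]] lt_i] /=.
- by congr (c _ _); apply: val_inj.
- by rewrite -h1; congr (c _ _); apply: val_inj.
- by congr (c _ _); apply: val_inj.
- by congr (c _ _); apply: val_inj.
Qed.
End System.

(** * The theorem *)

Theorem theorem5p3 (k : closedFieldType) (char3 : 3%N \in [pchar k])
    (a4 a5 a7 a8 : k)
    (simple : only_simple_roots (a12 a4 a5 a7 a8)^`()) :
  zmod_closed (solutions a4 a5 a7 a8) /\
  exists r : nat,
    MW_torsion_rank (a12 a4 a5 a7 a8) r /\
    isog_Z3 (solutions a4 a5 a7 a8) +%R r.
Proof.
have k3 : 3%:R = 0 :> k by apply: pcharf0.
have da0 := a12_deriv_neq0 k3 a4 a5 a7 a8.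
have S_zmod := solutions_zmod_closed k3 a4 a5 a7 a8.
split=> //.
have [s Ss] := solutions_finite a4 a5 a7 a8.
have exp3 (c : 'rV[k]_4) : c \in solutions a4 a5 a7 a8 -> c *+ 3 = 0.
  by move=> _; rewrite -scaler_nat k3 scale0r.
have [r S_isog] := finite_exponent3_isog S_zmod exp3 Ss.
exists r; split=> //; have [g [g_inj g_onto gD]] := S_isog.
have g_eq v : numerator_eq (a12 a4 a5 a7 a8) (numerator_of (g v)).
  by apply/numerator_of_solution => //; apply/g_onto; exists v.
exists (fun v => numerator_section (a12 a4 a5 a7 a8) (numerator_of (g v))).
split=> [v w|P|v w].
- by move/(numerator_section_inj k3 da0 (g_eq v) (g_eq w))/(numerator_of_inj k3)/g_inj.
- split=> [/(numerator_section_onto k3 da0)[w w_eq wP]|[v vP]].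
    have [c cw] := numerator_eq_of k3 w_eq.
    rewrite -cw in w_eq wP.
    have /g_onto[v gv] := (numerator_of_solution k3 a4 a5 a7 a8 c).2 w_eq.
    by exists v; rewrite gv.
  by rewrite -vP; apply: numerator_section_MW.
rewrite gD (numerator_ofD k3).
exact: (numerator_sectionD k3 da0 (g_eq v) (g_eq w)).
Qed.
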